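(* For every odd integer $n\geq 1$ and every (positive) divisor $t$ of $n$, there exists a pair of orthogonal cyclic $P_n$-decompositions of $K_{\frac{2n^2+t}{t}\times t}$.
   Context: $K_{q\times r}$ denotes the complete multipartite graph with $q$ parts each of size $r$. $P_k$ denotes the path of length $k$, i.e. with $k$ edges and $k+1$ distinct vertices. A $\Gamma$-decomposition of a graph $K$ is a set of subgraphs of $K$ (called blocks), all isomorphic to $\Gamma$, whose edge-sets partition the edge-set of $K$. A $\Gamma$-decomposition $\mathcal{D}$ of a graph $K$ on $v$ vertices is cyclic if, up to isomorphism, $V(K)=\mathbb{Z}_v$ and for every $B\in\mathcal{D}$ also $B+1\in\mathcal{D}$ (where $B+1$ is obtained by adding $1$ modulo $v$ to each vertex of $B$). Two decompositions $\mathcal{D}$ and $\mathcal{D}'$ of the same graph are orthogonal if $|E(B)\cap E(B')|\leq 1$ for all $B\in\mathcal{D}$ and $B'\in\mathcal{D}'$. *)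

(* Defs.v *)
From mathcomp Require Import all_boot.

Set Implicit Arguments.
Unset Strict Implicit.
Unset Printing Implicit Defensive.

(* A graph whose vertices lie in T: vertex set and edge set, edges being
   unordered pairs encoded as two-element sets. Well-formedness is not part of
   the type, but [multipartite] and [path_graph] are simple graphs by
   construction, hence so are all their isomorphic images. *)
Definition graph (T : finType) := ({set T} * {set {set T}})%type.

Definition vertices (T : finType) (G : graph T) : {set T} := G.1.
Definition edges (T : finType) (G : graph T) : {set {set T}} := G.2.

Definition subgraph (T : finType) (G H : graph T) : Prop :=
  vertices G \subset vertices H /\ edges G \subset edges H.

Definition map_graph (T U : finType) (f : T -> U) (G : graph T) : graph U :=
  (f @: vertices G, [set f @: e | e : {set T} in edges G]).

Definition isomorphic (T U : finType) (G : graph T) (H : graph U) : Prop :=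
  exists f : T -> U, {in vertices G &, injective f} /\ map_graph f G = H.

(* K_{q x r}: vertex (i, a) is the a-th element of the i-th part. *)
Definition multipartite (q r : nat) : graph ('I_q * 'I_r)%type :=
  ([set: 'I_q * 'I_r],
   [set [set x; y] | x in [set: 'I_q * 'I_r],
                     y in [set y : 'I_q * 'I_r | x.1 != y.1]]).

(* P_k has k edges and k + 1 vertices. *)
Definition path_graph (k : nat) : graph 'I_k.+1 :=
  ([set: 'I_k.+1],
   [set [set i; j] | i in [set: 'I_k.+1],
                     j in [set j : 'I_k.+1 | j == i.+1 :> nat]]).

(* Injectivity of [edges] on D makes distinct blocks give distinct, hence
   disjoint, parts. *)
Definition decomposition (U T : finType) (Gamma : graph U) (K : graph T)
    (D : {set graph T}) : Prop :=
  [/\ forall B, B \in D -> subgraph B K /\ isomorphic Gamma B,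
      {in D &, injective (@edges T)}
    & partition [set edges B | B : graph T in D] (edges K)].

(* Z_v is 'I_v, and adding 1 modulo v is [ordS]; unlike 'Z_v this is also
   correct for v = 1. *)
Definition shift_closed (v : nat) (D : {set graph 'I_v}) : Prop :=
  forall B, B \in D -> map_graph (@ordS v) B \in D.

Definition identification (T : finType) (v : nat) (K : graph T)
    (phi : T -> 'I_v) : Prop :=
  {in vertices K &, injective phi} /\ phi @: vertices K = [set: 'I_v].

(* D is cyclic once V(K) is identified with Z_v through phi. *)
Definition cyclic_under (T : finType) (v : nat) (K : graph T)
    (phi : T -> 'I_v) (D : {set graph T}) : Prop :=
  identification K phi /\
  shift_closed [set map_graph phi B | B : graph T in D].

Definition orthogonal (T : finType) (D D' : {set graph T}) : Prop :=
  forall B B', B \in D -> B' \in D' -> #|edges B :&: edges B'| <= 1.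

(* Main.v *)
Require Import Defs.
From mathcomp Require Import all_boot.
From mathcomp Require Import ssralg zmodp zify ring.

Set Implicit Arguments.
Unset Strict Implicit.
Unset Printing Implicit Defensive.

(* Call a difference admissible if it is not divisible by q = v / t, so that K is
   the Cayley graph of Z_v on the admissible differences. Since q - 1 = 2 n^2 / t
   and t is odd, there are exactly n^2 non-multiples of q strictly between 0 and
   v / 2. Write them in increasing order, row by row, in an n x n array: they
   increase along every row and every column. If 0 < x_0 < ... < x_{n-1} < v / 2,
   each sum of consecutive terms of x_0, - x_1, x_2, ... is nonzero and at most
   x_{n-1} in absolute value, so the partial sums are distinct modulo v and form
   a path whose edges have differences +-x_j. The translates of the n row paths
   use every edge of K once, and so do those of the n column paths. A row and a
   column share one entry, so a translate of the row path and a translate of the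
   column path share at most one edge. *)

Import GRing.Theory.

(** * Two-element sets and images of graphs *)

Lemma eq_set2 (T : finType) (a b c d : T) :
  [set a; b] = [set c; d] -> (a = c /\ b = d) \/ (a = d /\ b = c).
Proof.
move=> e.
have := set21 a b; have := set22 a b; rewrite e !inE.
have := set21 c d; have := set22 c d; rewrite -e !inE.
by do 4![case/orP=> /eqP ?]; subst; auto.
Qed.

Lemma map_graph_comp (T U V : finType) (g : U -> V) (f : T -> U) (G : graph T) :
  map_graph g (map_graph f G) = map_graph (g \o f) G.
Proof.
rewrite /map_graph /vertices /edges /= -!imset_comp; congr pair.
by apply: eq_imset => e /=; rewrite -imset_comp.
Qed.

Lemma eq_map_graph (T U : finType) (f g : T -> U) (G : graph T) :
  f =1 g -> map_graph f G = map_graph g G.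
Proof.
move=> fg; rewrite /map_graph; congr pair; first exact: eq_imset.
by apply: eq_imset => e; apply: eq_imset.
Qed.

(** * Alternating sums of increasing sequences *)

Section Alternating.

Local Open Scope ring_scope.

Definition altsum (R : pzRingType) (x : nat -> nat) (j : nat) : R :=
  \sum_(l < j) (-1) ^+ l * (x l)%:R.

Lemma altsumS (R : pzRingType) (x : nat -> nat) (j : nat) :
  altsum R x j.+1 = altsum R x j + (-1) ^+ j * (x j)%:R.
Proof. by rewrite /altsum big_ord_recr. Qed.

(* Peeling off the last term: if the tail sum up to k has absolute value m with
   0 < m <= x k and the sign of its last term, the next one has absolute value
   x k.+1 - m. *)
Lemma altsum_gap (R : pzRingType) (x : nat -> nat) (j k : nat) :
  (forall l, (x l < x l.+1)%N) -> (0 < x 0)%N -> (j <= k)%N ->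
  exists2 m, (0 < m <= x k)%N &
    altsum R x k.+1 - altsum R x j = (-1) ^+ k * m%:R.
Proof.
move=> xS x0; elim: k => [|k IH] jk.
  exists (x 0); first by rewrite x0 leqnn.
  by rewrite altsumS; move: jk; rewrite leqn0 => /eqP->; rewrite addrC addKr.
have xS_gt0 : (0 < x k.+1)%N by apply: leq_trans (xS k).
rewrite altsumS; move: jk; rewrite leq_eqVlt ltnS => /orP[/eqP->|/IH[m m_bd E]].
  by exists (x k.+1); rewrite ?xS_gt0 ?leqnn // addrC addKr.
exists (x k.+1 - m)%N; first by have := xS k; lia.
rewrite addrAC E natrB; last by have := xS k; lia.
by rewrite exprS mulrBr mulN1r !mulNr opprK addrC.
Qed.

End Alternating.

(** * Translates of alternating-sum paths in Z_v *)

Section CyclicPaths.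

Local Open Scope ring_scope.

Variables (p n : nat) (T : finType).
Local Notation v := p.+2.
Local Notation G := 'I_v.
Variables (phi : T -> G) (psi : G -> T).
Hypotheses (psiK : cancel psi phi) (odd_v : odd v) (n_gt0 : (0 < n)%N).

Definition path_block (f : nat -> G) (s : G) : graph T :=
  map_graph (fun j : 'I_n.+1 => psi (f j + s)) (path_graph n).

Definition path_edge (f : nat -> G) (j : nat) (s : G) : {set T} :=
  [set psi (f j + s); psi (f j.+1 + s)].

Lemma edges_path_block f s :
  edges (path_block f s) = [set path_edge f j s | j : 'I_n].
Proof.
apply/setP=> e; apply/imsetP/imsetP => [[e']|[j _ ->]].
  case/imset2P=> i j _; rewrite inE => /eqP ij -> ->.
  have i_n : (i < n)%N by have := ltn_ord j; rewrite ij ltnS.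
  exists (Ordinal i_n) => //.
  by rewrite imsetU !imset_set1 /path_edge /= ij.
exists [set widen_ord (leqnSn n) j; lift ord0 j].
  by apply/imset2P; exists (widen_ord (leqnSn n) j) (lift ord0 j); rewrite ?inE.
by rewrite imsetU !imset_set1.
Qed.

Lemma eq_path_edge f g j k s u :
  path_edge f j s = path_edge g k u ->
  (f j + s = g k + u /\ f j.+1 - f j = g k.+1 - g k)
  \/ f j.+1 - f j = - (g k.+1 - g k).
Proof.
have E (h : nat -> G) i w : h i.+1 - h i = (h i.+1 + w) - (h i + w) by ring.
case/eq_set2=> -[/(can_inj psiK) e1 /(can_inj psiK) e2]; [left|right].
  by split=> //; rewrite (E f j s) (E g k u) e1 e2.
by rewrite (E f j s) (E g k u) e1 e2 opprB.
Qed.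

Lemma natr_Zp_eq (a b : nat) : (a%:R == b%:R :> G) = (a == b %[mod v]).
Proof. by rewrite -val_eqE !Zp_nat. Qed.

Lemma natr_Zp_eqN (a b : nat) : (a%:R == - b%:R :> G) = (v %| a + b)%N.
Proof. by rewrite -subr_eq0 opprK -natrD -[0]/(0%:R) natr_Zp_eq mod0n. Qed.

(** Below [v / 2], the difference of [x] and [y] is less than [v] in absolute value and
    [0 < x + y < v], so neither congruence can hold unless [x = y]. *)
Lemma natr_Zp_pm_inj (x y : nat) :
  (x.*2 < v)%N -> (y.*2 < v)%N -> (0 < x)%N ->
  x%:R = y%:R :> G \/ x%:R = - y%:R :> G -> x = y.
Proof.
move=> xv yv x0 [] /eqP; first by rewrite natr_Zp_eq !modn_small; lia.
by rewrite natr_Zp_eqN => /dvdn_leq; lia.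
Qed.

Lemma altsum_step x j : altsum G x j.+1 - altsum G x j = (-1) ^+ j * (x j)%:R.
Proof. by rewrite altsumS addrC addKr. Qed.

Lemma altsum_step_pm x j :
  altsum G x j.+1 - altsum G x j = (x j)%:R
  \/ altsum G x j.+1 - altsum G x j = - (x j)%:R.
Proof.
by rewrite altsum_step -signr_odd; case: (odd j); rewrite ?mul1r ?mulN1r; auto.
Qed.

(** Whichever way an edge is traversed, its difference is, up to sign, the entry it comes from.
    Disjointness of blocks and orthogonality both rest on this. *)
Lemma path_edge_altsum x y j k s u :
  ((x j).*2 < v)%N -> ((y k).*2 < v)%N -> (0 < x j)%N ->
  path_edge (altsum G x) j s = path_edge (altsum G y) k u -> x j = y k.
Proof.
move=> xv yv x0 /eq_path_edge;
move=> H; apply: natr_Zp_pm_inj => //.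
have {H} : altsum G x j.+1 - altsum G x j = (y k)%:R
        \/ altsum G x j.+1 - altsum G x j = - (y k)%:R.
  by case: H => [[_ ->]|->]; case: (altsum_step_pm y k) => ->;
    rewrite ?opprK; auto.
case: (altsum_step_pm x j) => -> //.
by case=> /(congr1 -%R); rewrite ?opprK => ->; auto.
Qed.

(** If the two edges matched with ends reversed, [v] would divide [2 * x j], which lies strictly
    between 0 and [v]. *)
Lemma path_edge_shift x j s u :
  ((x j).*2 < v)%N -> (0 < x j)%N ->
  path_edge (altsum G x) j s = path_edge (altsum G x) j u -> s = u.
Proof.
move=> xv x0 /eq_path_edge[[/addrI]//|]; case: (altsum_step_pm x j) => -> /eqP;
  rewrite ?eqr_opp natr_Zp_eqN => /dvdn_leq; lia.
Qed.

(** By [altsum_gap], two partial sums differ by [m] or [- m] with [0 < m < v / 2], which is nonzero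
    modulo [v]. *)
Lemma altsum_inj x (j k : 'I_n.+1) :
  (forall l, x l < x l.+1)%N -> (0 < x 0)%N ->
  (forall l, l < n -> (x l).*2 < v)%N ->
  altsum G x j = altsum G x k -> j = k.
Proof.
move=> x_incr x0 x_half; wlog jk : j k / (j < k)%N.
  move=> H; case: (ltngtP j k) => [|| /val_inj //]; first exact: H.
  by move=> /H {}H /esym /H.
case: k jk => -[//|k] k_n /= jk e; exfalso.
have [m m_bd] := altsum_gap G x_incr x0 (jk : (j <= k)%N).
rewrite e subrr => /esym/eqP.
have -> : ((-1) ^+ k * m%:R == 0 :> G) = (m%:R == 0%:R :> G).
  by rewrite -signr_odd; case: (odd k); rewrite ?mulN1r ?oppr_eq0 ?mul1r.
rewrite natr_Zp_eq mod0n => /dvdn_leq.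
by have := x_half k k_n; lia.
Qed.

(** * The decomposition into all translates of the row paths of an array *)

Definition path_family (a : nat -> nat -> nat) : {set graph T} :=
  [set path_block (altsum G (a w.1)) w.2 | w : 'I_n * G].

Lemma path_family_shift_closed a :
  shift_closed [set map_graph phi B | B : graph T in path_family a].
Proof.
move=> _ /imsetP[_ /imsetP[[i s] _ ->] ->] /=.
apply/imsetP; exists (path_block (altsum G (a i)) (s + 1)).
  by apply/imsetP; exists (i, s + 1).
rewrite /path_block !map_graph_comp; apply: eq_map_graph => j /=.
rewrite !psiK addrA; apply: val_inj => /=.
by rewrite modnDmr addn1.
Qed.

(* Only the n x n corner of a is used; a and its monotonicity extend to all
   indices because altsum takes sequences on nat. *)
Definition heffter_like (N : pred G) (a : nat -> nat -> nat) : Prop :=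
  [/\ forall i j, (a i j < a i j.+1)%N, forall i, (0 < a i 0)%N,
      forall i j, (i < n)%N -> (j < n)%N -> ((a i j).*2 < v)%N,
      forall i j i' j' : 'I_n, a i j = a i' j' -> i = i' /\ j = j'
    & forall z, N z <->
        exists i j : 'I_n, z = (a i j)%:R \/ z = - (a i j)%:R].

(** Through [psi], [K] is the Cayley graph of Z_v with connection set [N]. *)
Variables (N : pred G) (K : graph T).
Hypothesis vertices_K : vertices K = setT.
Hypothesis edges_K : forall e, e \in edges K <->
  exists x y, e = [set psi x; psi y] /\ N (y - x).

Lemma heffter_like_pos a i j : heffter_like N a -> (0 < a i j)%N.
Proof.
by case=> a_incr a0 _ _ _; case: j => // j; apply: leq_trans (a_incr i j).
Qed.

Lemma path_edge_K a (i j : 'I_n) s : heffter_like N a ->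
  path_edge (altsum G (a i)) j s \in edges K.
Proof.
case=> _ _ _ _ aN; apply/edges_K.
exists (altsum G (a i) j + s), (altsum G (a i) j.+1 + s); split=> //.
have -> : altsum G (a i) j.+1 + s - (altsum G (a i) j + s)
        = altsum G (a i) j.+1 - altsum G (a i) j by ring.
by apply/aN; exists i, j; apply: altsum_step_pm.
Qed.

Lemma path_edge_family_inj a (i j i' j' : 'I_n) s s' : heffter_like N a ->
  path_edge (altsum G (a i)) j s = path_edge (altsum G (a i')) j' s' ->
  (i, s) = (i', s').
Proof.
move=> ha e; have [_ _ a_half a_inj _] := ha.
have /a_inj[? ?] : a i j = a i' j'.
  by apply: path_edge_altsum e; rewrite ?a_half ?heffter_like_pos.
subst i' j'; congr pair.
by apply: path_edge_shift e; rewrite ?a_half ?heffter_like_pos.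
Qed.

Lemma path_family_cover a e : heffter_like N a -> e \in edges K ->
  exists (i j : 'I_n) s, e = path_edge (altsum G (a i)) j s.
Proof.
case=> _ _ _ _ aN /edges_K[x [y [-> /aN[i [j dyx]]]]]; exists i, j.
(* This translate carries the [j]-th vertex of the path to [z]; equality of differences then puts
   the next vertex at [w]. *)
have edge_at (z w : G) : w - z = altsum G (a i) j.+1 - altsum G (a i) j ->
    [set psi z; psi w] = path_edge (altsum G (a i)) j (z - altsum G (a i) j).
  move=> dwz; rewrite /path_edge; congr [set psi _; psi _]; first by ring.
  have -> : w = z + (w - z) by ring.
  by rewrite dwz; ring.
have [dE|dE] : y - x = altsum G (a i) j.+1 - altsum G (a i) j
           \/ x - y = altsum G (a i) j.+1 - altsum G (a i) j.
  rewrite -(opprB y x).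
  by case: (altsum_step_pm (a i) j) dyx => -> [] ->; rewrite ?opprK; auto.
- by exists (x - altsum G (a i) j); apply: edge_at.
- by exists (y - altsum G (a i) j); rewrite setUC; apply: edge_at.
Qed.

Lemma path_family_decomposition a : heffter_like N a ->
  decomposition (path_graph n) K (path_family a).
Proof.
move=> ha; have [a_incr a0 a_half _ _] := ha.
have j0 : 'I_n := Ordinal n_gt0.
(* One shared edge identifies two blocks. As every block has an edge ([edge0]), this yields both
   injectivity of [edges] and disjointness. *)
have block_eq (u w : 'I_n * G) e :
    e \in edges (path_block (altsum G (a u.1)) u.2) ->
    e \in edges (path_block (altsum G (a w.1)) w.2) -> u = w.
  rewrite !edges_path_block => /imsetP[j _ ->] /imsetP[j' _].
  by case: u w => [i s] [i' s'] /= /path_edge_family_inj; apply.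
have edge0 (u : 'I_n * G) :
    path_edge (altsum G (a u.1)) j0 u.2
      \in edges (path_block (altsum G (a u.1)) u.2).
  by rewrite edges_path_block; apply/imsetP; exists j0.
split.
- move=> _ /imsetP[[i s] _ ->] /=; split.
    split; first by rewrite vertices_K subsetT.
    apply/subsetP => e; rewrite edges_path_block => /imsetP[j _ ->].
    exact: path_edge_K.
  exists (fun j : 'I_n.+1 => psi (altsum G (a i) j + s)); split=> // j k _ _.
  move/(can_inj psiK)/addIr; apply: altsum_inj => // l l_n.
  exact: a_half.
- move=> _ _ /imsetP[u _ ->] /imsetP[w _ ->] e.
  by have ew := edge0 u; rewrite e in ew; rewrite (block_eq _ _ _ (edge0 u) ew).
apply/and3P; split.
- apply/eqP/setP=> e; apply/bigcupP/idP.
    case=> _ /imsetP[_ /imsetP[[i s] _ ->] ->].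
    by rewrite edges_path_block => /imsetP[j _ ->]; apply: path_edge_K.
  case/(path_family_cover ha) => i [j [s ->]].
  exists (edges (path_block (altsum G (a i)) s)).
    by apply/imset_f/imsetP; exists (i, s).
  by rewrite edges_path_block; apply/imsetP; exists j.
- apply/trivIsetP => _ _ /imsetP[_ /imsetP[u _ ->] ->]
    /imsetP[_ /imsetP[w _ ->] ->].
  apply: contraR => /pred0Pn[e /andP[/= eu ew]].
  by rewrite (block_eq u w e).
- apply/imsetP=> -[_ /imsetP[u _ ->] e0].
  by have := edge0 u; rewrite -e0 inE.
Qed.

Lemma path_family_orthogonal a : heffter_like N a ->
  orthogonal (path_family a) (path_family (fun i j => a j i)).
Proof.
move=> ha _ _ /imsetP[[i s] _ ->] /imsetP[[k u] _ ->].
have [_ _ a_half a_inj _] := ha.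
(* Row [i] and column [k] share only the entry [a i k], so the only possible common edge is the one
   at position [k] of the row path. *)
rewrite -(cards1 (path_edge (altsum G (a i)) k s)) subset_leq_card //.
apply/subsetP=> e; rewrite !edges_path_block !inE.
case/andP=> /imsetP[j _ ->] /imsetP[l _] /path_edge_altsum E.
have /a_inj[_ ->] // : a i j = a l k.
by apply: E; rewrite ?a_half ?heffter_like_pos.
Qed.

End CyclicPaths.

(** * Increasing enumeration of the non-multiples of [m.+1] *)

Definition nonmultiple (m k : nat) : nat := (k + k %/ m).+1.

Lemma nonmultiple_leq m : {mono nonmultiple m : k l / k <= l}.
Proof.
apply: leq_mono => k l kl.
by rewrite /nonmultiple ltnS -addSn leq_add // leq_div2r // ltnW.
Qed.

Lemma nonmultiple_ltn m : {mono nonmultiple m : k l / k < l}.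
Proof. exact/leqW_mono/nonmultiple_leq. Qed.

Lemma nonmultiple_inj m : injective (nonmultiple m).
Proof. exact/incn_inj/nonmultiple_leq. Qed.

(** For [m > 0] this is the Euclidean division by [m.+1]: each interval between consecutive
    multiples contains [m] values, with remainders 1 to [m]. *)
Lemma nonmultipleE m k :
  nonmultiple m k = k %/ m * m.+1 + (k %% m).+1.
Proof. by rewrite /nonmultiple {1}(divn_eq k m) mulnS addnS addnC addnA. Qed.

Lemma nonmultiple_mod m k : 0 < m -> ~~ (m.+1 %| nonmultiple m k).
Proof.
move=> m0; rewrite nonmultipleE dvdn_addr ?dvdn_mull //.
by rewrite gtnNdvd // ltnS ltn_mod.
Qed.

Lemma nonmultiple_surj m z : ~~ (m.+1 %| z) -> exists k, z = nonmultiple m k.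
Proof.
rewrite /dvdn; case E: (z %% m.+1) => [//|r] _.
have r_m : r < m by rewrite -ltnS -E ltn_mod.
exists (z %/ m.+1 * m + r).
have m_gt0 : 0 < m by apply: leq_trans r_m.
rewrite nonmultipleE divnMDl // modnMDl (divn_small r_m) (modn_small r_m).
by rewrite addn0 -E -divn_eq.
Qed.

(* With t = 2b + 1 and m = 2h, both sides say k < b m + h, i.e. that
   nonmultiple m k is at most b (m + 1) + h = ((m + 1) t - 1) / 2. *)
Lemma nonmultiple_half m t k : 0 < m -> odd t -> ~~ odd m ->
  ((nonmultiple m k).*2 < m.+1 * t) = (k.*2 < m * t).
Proof.
move=> m0 odd_t even_m; rewrite nonmultipleE {3}(divn_eq k m).
move: (k %/ m) (k %% m) (ltn_pmod k m0) => a r rm.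
have -> : t = t./2.*2.+1 by rewrite -[LHS]odd_double_half odd_t.
have mE : m = m./2.*2 by rewrite -[LHS]odd_double_half (negbTE even_m).
move: t./2 m./2 mE => b h mE {odd_t even_m m0}.
case: (ltngtP a b) => [ab|ba|->].
- have [d ->] : exists d, b = a + d.+1 by exists (b - a).-1; lia.
  by transitivity true; lia.
- have [d ->] : exists d, a = b + d.+1 by exists (a - b).-1; lia.
  by transitivity false; lia.
- by rewrite mE; lia.
Qed.

(** * The array of admissible differences *)

Section Array.

Local Open Scope ring_scope.

Variables (n t m p : nat).
Hypotheses (n_gt0 : (0 < n)%N) (odd_t : odd t) (m_gt0 : (0 < m)%N).
Hypotheses (vE : (p.+2 = m.+1 * t)%N) (mtE : (m * t = 2 * n ^ 2)%N).

Lemma even_m : ~~ odd m.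
Proof. by have := congr1 odd mtE; rewrite !oddM odd_t andbT => ->. Qed.

Definition array (i j : nat) : nat := nonmultiple m (n * i + j).

Lemma array_half i j :
  (i < n)%N -> (j < n)%N -> ((array i j).*2 < p.+2)%N.
Proof.
by move=> i_n j_n; rewrite vE nonmultiple_half ?even_m // mtE; nia.
Qed.

Lemma array_inj (i j i' j' : 'I_n) :
  array i j = array i' j' -> i = i' /\ j = j'.
Proof.
move/nonmultiple_inj => e; split; apply/val_inj.
  have := congr1 (divn^~ n) e.
  by rewrite /= !(mulnC n) !divnMDl // !divn_small // !addn0.
have := congr1 (modn^~ n) e.
by rewrite /= !(mulnC n) !modnMDl !modn_small.
Qed.

Definition admissible : pred 'I_p.+2 := fun z => ~~ (m.+1 %| z).

Lemma admissibleN z : admissible (- z) = admissible z.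
Proof.
rewrite /admissible /= /dvdn modn_dvdm; last by rewrite vE dvdn_mulr.
have zv := ltnW (ltn_ord z).
by rewrite -!/(dvdn _ _) dvdn_subr // vE dvdn_mulr.
Qed.

(** The residue classes modulo [m.+1] are thus the parts of the multipartite graph; they are well
    defined on Z_v because [m.+1] divides [v]. *)
Lemma admissibleB x y :
  admissible (y - x) = (x != y %[mod m.+1]).
Proof.
have qv : (m.+1 %| p.+2)%N by rewrite vE dvdn_mulr.
rewrite /admissible /= /dvdn (modn_dvdm _ qv) -modnDmr (modn_dvdm _ qv) modnDmr.
rewrite -[X in _ != X](mod0n m.+1) -(eqn_modDr x) -addnA.
rewrite subnK ?(ltnW (ltn_ord x)) //.
by rewrite -modnDmr (eqP qv) addn0 add0n eq_sym.
Qed.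

Lemma array_cover z :
  admissible z <->
  exists i j : 'I_n, z = (array i j)%:R \/ z = - (array i j)%:R.
Proof.
have admR i j : (i < n)%N -> (j < n)%N -> admissible (array i j)%:R.
  move=> i_n j_n; rewrite /admissible Zp_nat /= modn_small ?nonmultiple_mod //.
  by have := array_half i_n j_n; lia.
split=> [|[i [j [] ->]]]; rewrite ?admissibleN ?admR //.
have small (w : 'I_p.+2) : (w.*2 < p.+2)%N -> admissible w ->
    exists i j : 'I_n, w = (array i j)%:R.
  move=> w_half /nonmultiple_surj[k wE].
  (* By [nonmultiple_half], being below [v / 2] means [2 * k < m * t = 2 * n ^ 2]; quotient and
     remainder of [k] by [n] then give row and column. *)
  have k_n2 : (k < n * n)%N.
    move: w_half; rewrite wE vE nonmultiple_half ?even_m // mtE; lia.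
  have i_n : (k %/ n < n)%N by rewrite ltn_divLR.
  exists (Ordinal i_n), (Ordinal (ltn_pmod k n_gt0)) => /=.
  by rewrite /array mulnC -divn_eq -wE natr_Zp.
(* Since [v = 2 * n ^ 2 + t] is odd, [2 * z] differs from [v], so [z] or [- z] has its
   representative below [v / 2]. *)
case: (ltnP z.*2 p.+2) => [zv /(small _ zv)[i [j ->]]|vz].
  by exists i, j; left.
rewrite -admissibleN => /small[|i [j zE]].
  by rewrite /=; have := ltn_ord z; rewrite modn_small; lia.
by exists i, j; right; rewrite -zE opprK.
Qed.

Lemma array_heffter : heffter_like n admissible array.
Proof.
split.
- by move=> i j; rewrite nonmultiple_ltn addnS.
- by [].
- exact: array_half.
- exact: array_inj.
- exact: array_cover.
Qed.

(** Moving down a column adds [n > 0] to the argument of the increasing map [nonmultiple], so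
    columns increase as rows do. *)
Lemma array_heffter_tr : heffter_like n admissible (fun i j => array j i).
Proof.
split.
- by move=> i j; rewrite nonmultiple_ltn mulnS; lia.
- by [].
- by move=> i j i_n j_n; apply: array_half.
- by move=> i j i' j' /array_inj[].
- move=> z; split=> [/array_cover|] [i [j E]]; first by exists j, i.
  by apply/array_cover; exists j, i.
Qed.

End Array.

(** * Identification of the multipartite graph with a Cayley graph of Z_v *)

Lemma multipartite_orthogonal_cyclic_paths (n t m p : nat) :
  0 < n -> odd t -> p.+2 = m.+1 * t -> p.+2 = 2 * n ^ 2 + t ->
  let K := multipartite m.+1 t in
  exists (phi : 'I_m.+1 * 'I_t -> 'I_p.+2)
         (D D' : {set graph ('I_m.+1 * 'I_t)%type}),
    [/\ decomposition (path_graph n) K D,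
        decomposition (path_graph n) K D',
        cyclic_under K phi D,
        cyclic_under K phi D'
      & orthogonal D D'].
Proof.
move=> n_gt0 odd_t vE vE' K.
have mtE : m * t = 2 * n ^ 2 by apply: (@addIn t); rewrite -vE' vE mulSn addnC.
have m_gt0 : 0 < m.
  by case: m mtE {K vE} => // /esym/eqP; rewrite mul0n muln_eq0 expn_eq0; lia.
have odd_v : odd p.+2 by rewrite vE' oddD oddM odd_t.
have div_lt (x : 'I_p.+2) : x %/ m.+1 < t by rewrite ltn_divLR // mulnC -vE.
(* The remainder modulo [m.+1] selects the part, the quotient the position inside it; [phi] below is
   the inverse. *)
pose psi (x : 'I_p.+2) : 'I_m.+1 * 'I_t :=
  (inord (x %% m.+1), Ordinal (div_lt x)).
have [phi phiE] : exists phi : 'I_m.+1 * 'I_t -> 'I_p.+2,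
    forall w, phi w = w.2 * m.+1 + w.1 :> nat.
  exists (fun w : 'I_m.+1 * 'I_t => inord (w.2 * m.+1 + w.1)) => -[i b].
  by rewrite inordK // vE /=; have := ltn_ord i; have := ltn_ord b; nia.
have psi1E x : (psi x).1 = x %% m.+1 :> nat by rewrite inordK // ltn_mod.
have phiK : cancel phi psi.
  case=> i b; congr pair; apply/val_inj; rewrite /= phiE.
    by rewrite modnMDl modn_small // inord_val.
  by rewrite divnMDl // divn_small // addn0.
have psiK : cancel psi phi.
  by move=> x; apply: ord_inj; rewrite phiE psi1E -divn_eq.
have edges_K e : e \in edges K <->
    exists x y, e = [set psi x; psi y] /\ admissible m (y - x)%R.
  have adj x y : admissible m (y - x)%R = ((psi x).1 != (psi y).1).
    by rewrite (admissibleB vE) -!psi1E.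
  split=> [/imset2P[x y _]|[x [y [-> xy]]]].
    by rewrite inE => xy ->; exists (phi x), (phi y); rewrite adj !phiK.
  by apply/imset2P; exists (psi x) (psi y); rewrite ?inE // -adj.
have ident : identification K phi.
  split; first by move=> x y _ _; apply: (can_inj phiK).
  apply/setP=> x; rewrite !inE; apply/imsetP.
  by exists (psi x); rewrite ?inE ?psiK.
have h := array_heffter n_gt0 odd_t m_gt0 vE mtE.
have hT := array_heffter_tr n_gt0 odd_t m_gt0 vE mtE.
exists phi, (path_family n psi (array n m)),
  (path_family n psi (fun i j => array n m j i)).
split.
- exact: path_family_decomposition h.
- exact: path_family_decomposition hT.
- by split=> //; apply: path_family_shift_closed.
- by split=> //; apply: path_family_shift_closed.
- exact: path_family_orthogonal h.
Qed.

Theorem theorem4p2 (n t : nat) (hn : odd n) (ht : t %| n) :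
  let v := 2 * n ^ 2 + t in
  let K := multipartite (v %/ t) t in
  exists (phi : 'I_(v %/ t) * 'I_t -> 'I_v)
         (D D' : {set graph ('I_(v %/ t) * 'I_t)%type}),
    [/\ decomposition (path_graph n) K D,
        decomposition (path_graph n) K D',
        cyclic_under K phi D,
        cyclic_under K phi D'
      & orthogonal D D'].
Proof.
have odd_t : odd t := dvdn_odd ht hn.
have t_gt0 : 0 < t by case: t odd_t {ht}.
have n_gt0 : 0 < n by case: n hn {ht}.
move=> v; have vE : v = 2 * n ^ 2 + t by [].
have vt : v = v %/ t * t.
  by rewrite divnK // dvdn_addl // dvdn_mull // expnS dvdn_mulr.
have n2_gt0 : 0 < n ^ 2 by rewrite expn_gt0 n_gt0.
have v_gt1 : 1 < v by rewrite vE; lia.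
have q_gt0 : 0 < v %/ t by rewrite divn_gt0 // vE leq_addl.
(* Writing [v] as [p.+2] gives ['I_v] its ring structure. *)
move: v (v %/ t) vE vt v_gt1 q_gt0 => [|[|p]] // [|m] // vE vt _ _ K.
exact: multipartite_orthogonal_cyclic_paths.
Qed.
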